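(* Let $k$ be a field. The assignment sending a graph $E$ to its Cohn path algebra $C_k(E)$ and sending a morphism $f$ from $E$ to $F$ in $MIPG$ to the map $f_*^C\colon C_k(E)\to C_k(F)$ determined by $$f_*^C([\chi_p])=[\chi_{\bar f(p)}]\quad\text{for all }p\in FP(\bar E),$$ defines a covariant functor from $MIPG$ to the category $KA$ of $k$-algebras and algebra homomorphisms. Furthermore, the same assignment restricted to the subcategory $MBPG$ yields a covariant functor to the category $UKA$ of unital $k$-algebras and unital algebra homomorphisms.
   Context: Graphs. A graph $E=(E^0,E^1,s_E,t_E)$ consists of a set $E^0$ of vertices, a set $E^1$ of edges, and source and target maps $s_E,t_E\colon E^1\to E^0$. A finite path is a vertex (length $0$) or a finite sequence $e_1\ldots e_n$ ($n\ge1$) of edges with $t_E(e_i)=s_E(e_{i+1})$. $FP(E)$ is the set of finite paths; $s_{PE},t_{PE}\colon FP(E)\to E^0$ are the beginning and end maps (a vertex begins and ends at itself). Path homomorphisms. A path homomorphism from $E$ to $F$ is a map $f\colon FP(E)\to FP(F)$ with $f(E^0)\subseteq F^0$, $s_{PF}\circ f=f\circ s_{PE}$, $t_{PF}\circ f=f\circ t_{PE}$, and $f(pq)=f(p)f(q)$ whenever $t_{PE}(p)=s_{PE}(q)$. For finite paths write $\alpha\preceq\beta$ iff $\beta=\alpha\gamma$ for some finite path $\gamma$. $MIPG$ is the category whose objects are graphs and whose morphisms are the path homomorphisms that are injective on vertices and satisfy the monotonicity condition: $f(e)\preceq f(e')\Rightarrow e=e'$ for all edges $e,e'$. $MBPG$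 is its subcategory whose objects are graphs with finitely many vertices and whose morphisms are those morphisms of $MIPG$ that are bijective on vertices. Algebras. The path algebra $kE$ is the $k$-vector space with basis $\{\chi_p\}_{p\in FP(E)}$ and multiplication $\chi_p\chi_q=\chi_{pq}$ if $t_{PE}(p)=s_{PE}(q)$ and $0$ otherwise ($kE=0$ if $E=\emptyset$). The extended graph $\bar E$ has $\bar E^0=E^0$, $\bar E^1=E^1\sqcup\{e^*\mid e\in E^1\}$, with $s_{\bar E}(e)=s_E(e)$, $t_{\bar E}(e)=t_E(e)$, $s_{\bar E}(e^* )=t_E(e)$, $t_{\bar E}(e^* )=s_E(e)$. For $p=e_1\ldots e_n\in FP(E)$, $p^*:=e_n^*\ldots e_1^*\in FP(\bar E)$, and $v^*:=v$ for a vertex $v$. The Cohn path algebra $C_k(E)$ is the quotient of $k\bar E$ by the ideal generated by $\chi_{e^*}\chi_{e'}-\delta_{e,e'}\chi_{t_E(e)}$ for $e,e'\in E^1$; $[\cdot]$ denotes classes in the quotient. For a path homomorphism $f$ from $E$ to $F$, $\bar f\colon FP(\bar E)\to FP(\bar F)$ is the path homomorphism with $\bar f(v)=f(v)$, $\bar f(e)=f(e)$, $\bar f(e^* )=f(e)^*$ for $v\in E^0$, $e\in E^1$, and $\bar f(x_1\ldots x_n)=\bar f(x_1)\ldots\bar f(x_n)$ for $x_i\in\bar E^1$. *)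

(* Defs.v *)
From HB Require Import structures.
From mathcomp Require Import all_boot all_algebra finmap.
From mathcomp Require Import boolp classical_sets cardinality.
From mathcomp.multinomials Require Import xfinmap monalg.

Set Implicit Arguments.
Unset Strict Implicit.
Unset Printing Implicit Defensive.

Import GRing.Theory.

Local Open Scope fset_scope.
Local Open Scope ring_scope.
Local Open Scope quotient_scope.
Local Open Scope classical_set_scope.

Record category := Category {
  ob :> Type;
  mor : ob -> ob -> Type;
  idm : forall X, mor X X;
  compc : forall X Y Z, mor Y Z -> mor X Y -> mor X Z;
  comp_idl : forall X Y (f : mor X Y), compc (idm Y) f = f;
  comp_idr : forall X Y (f : mor X Y), compc f (idm X) = f;
  compA : forall X Y Z W (h : mor Z W) (g : mor Y Z) (f : mor X Y),
    compc h (compc g f) = compc (compc h g) f }.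

Arguments mor : clear implicits.
Arguments idm {c} X.
Arguments compc {c X Y Z}.

Definition is_functor (C D : category) (F0 : C -> D)
    (F1 : forall X Y, mor C X Y -> mor D (F0 X) (F0 Y)) : Prop :=
  (forall X, F1 X X (idm X) = idm (F0 X)) /\
  (forall X Y Z (g : mor C Y Z) (f : mor C X Y),
     F1 X Z (compc g f) = compc (F1 Y Z g) (F1 X Y f)).

Section Subcategory.
Variables (C : category) (P : C -> Prop)
  (Q : forall X Y, mor C X Y -> Prop).
Hypothesis Q_id : forall X, Q (idm X).
Hypothesis Q_comp : forall X Y Z (g : mor C Y Z) (f : mor C X Y),
  Q g -> Q f -> Q (compc g f).

Definition subcategory : category.
Proof.
refine (@Category {X : C | P X}
  (fun X Y => {f : mor C (sval X) (sval Y) | Q f})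
  (fun X => exist _ (idm (sval X)) (Q_id (sval X)))
  (fun X Y Z g f => exist _ (compc (sval g) (sval f))
                      (Q_comp (svalP g) (svalP f))) _ _ _).
- by move=> X Y [f Qf]; apply: eq_exist; exact: comp_idl.
- by move=> X Y [f Qf]; apply: eq_exist; exact: comp_idr.
- by move=> X Y Z W h g f; apply: eq_exist; exact: compA.
Defined.

End Subcategory.

Lemma catI (T : Type) (s t u : seq T) : s ++ t = s ++ u -> t = u.
Proof. by elim: s => //= x s IH [] /IH. Qed.

Lemma cat_cmp (T : Type) (s t u w : seq T) : s ++ u = t ++ w ->
  (exists x, t = s ++ x) \/ (exists x, s = t ++ x).
Proof.
elim: s t => [|x s IH] [|y t] /=; [by left; exists [::]|by left; exists (y :: t)
  |by right; exists (x :: s)|].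
by move=> [-> /IH[[v ->]|[v ->]]]; [left|right]; exists v.
Qed.

Record graph := Graph {
  vertex : Type;
  edge : Type;
  src : edge -> vertex;
  tgt : edge -> vertex }.

Arguments src {g}.
Arguments tgt {g}.

Fixpoint chain (E : graph) (v : vertex E) (s : seq (edge E)) : Prop :=
  if s is e :: s' then src e = v /\ chain (tgt e) s' else True.

(* The path [e_1 ... e_n], n >= 1, has [source = src e_1] and
   [edges = [:: e_1; ...; e_n]]; the vertex [v] has [source = v] and no
   edges. *)
Record fin_path (E : graph) := FPath {
  source : vertex E;
  edges : seq (edge E);
  chainP : chain source edges }.

HB.instance Definition _ E := gen_eqMixin (fin_path E).
HB.instance Definition _ E := gen_choiceMixin (fin_path E).

Section Paths.
Variable E : graph.
Implicit Types (v : vertex E) (e : edge E) (p q r : fin_path E).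
Implicit Types (s : seq (edge E)).

Definition endpoint v s : vertex E := last v (map tgt s).

Definition target p : vertex E := endpoint (source p) (edges p).

Definition vpath v : fin_path E := @FPath E v [::] I.

Definition epath e : fin_path E := @FPath E (src e) [:: e] (conj erefl I).

Lemma fin_path_eq p q : source p = source q -> edges p = edges q -> p = q.
Proof.
case: p q => v s c [v' s' c'] /= vv ss; move: c c'; rewrite vv ss => c c'.
by rewrite (Prop_irrelevance c c').
Qed.

Lemma chain_cat v s s' :
  chain v (s ++ s') <-> chain v s /\ chain (endpoint v s) s'.
Proof.
elim: s v => [|e s IH] v /=; first by split => // -[].
by split=> [[? /IH[? ?]]|[[? ?] ?]]; split=> //; apply/IH.
Qed.

Lemma endpoint_cat v s s' :
  endpoint v (s ++ s') = endpoint (endpoint v s) s'.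
Proof. by rewrite /endpoint map_cat last_cat. Qed.

Lemma concat_chain p q :
  target p = source q -> chain (source p) (edges p ++ edges q).
Proof.
move=> h; apply/chain_cat; split; first exact: chainP.
by move: h; rewrite /target => ->; exact: chainP.
Qed.

Definition concat p q (pq : target p = source q) : fin_path E :=
  FPath (concat_chain pq).

(* Totalized concatenation: the value [p] for non-composable [p], [q] is
   junk. *)
Definition pcat p q : fin_path E :=
  if pselect (target p = source q) is left pq then concat pq else p.

Lemma source_pcat p q : source (pcat p q) = source p.
Proof. by rewrite /pcat; case: pselect. Qed.

Lemma edges_pcat p q :
  target p = source q -> edges (pcat p q) = edges p ++ edges q.
Proof. by rewrite /pcat; case: pselect. Qed.

Lemma target_pcat p q : target p = source q -> target (pcat p q) = target q.
Proof.
move=> pq; rewrite {1}/target source_pcat edges_pcat // endpoint_cat.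
by rewrite -/(target p) pq.
Qed.

Lemma target_vpath v : target (vpath v) = v. Proof. by []. Qed.

Lemma target_epath e : target (epath e) = tgt e. Proof. by []. Qed.

Lemma pcatA p q r : target p = source q -> target q = source r ->
  pcat p (pcat q r) = pcat (pcat p q) r.
Proof.
move=> pq qr; apply: fin_path_eq; first by rewrite !source_pcat.
by rewrite !edges_pcat ?source_pcat ?target_pcat // catA.
Qed.

Lemma pcat_vl v p : v = source p -> pcat (vpath v) p = p.
Proof.
move=> vp; apply: fin_path_eq; first by rewrite source_pcat.
by rewrite edges_pcat.
Qed.

Lemma pcat_vr p v : target p = v -> pcat p (vpath v) = p.
Proof.
move=> pv; apply: fin_path_eq; first by rewrite source_pcat.
by rewrite edges_pcat // cats0.
Qed.

Lemma fin_path_cons p e s : edges p = e :: s ->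
  exists q, [/\ edges q = s, source q = tgt e & p = pcat (epath e) q].
Proof.
case: p => v es c /= ees; move: c; rewrite ees => c.
exists (@FPath E (tgt e) s c.2); split=> //.
apply: fin_path_eq; first by rewrite source_pcat /= c.1.
by rewrite edges_pcat.
Qed.

Lemma fin_path_nil p : edges p = [::] -> p = vpath (source p).
Proof. by move=> p0; exact: fin_path_eq. Qed.

Definition path_prefix p q : Prop :=
  exists2 r, target p = source r & q = pcat p r.

Lemma path_prefixE p q : path_prefix p q <->
  source p = source q /\ exists s, edges q = edges p ++ s.
Proof.
split=> [[r pr ->]|[pq [s qs]]].
  by rewrite source_pcat; split=> //; exists (edges r); rewrite edges_pcat.
have c : chain (target p) s.
  by have := chainP q; rewrite qs -pq => /chain_cat[].
exists (FPath c) => //; apply: fin_path_eq; first by rewrite source_pcat.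
by rewrite edges_pcat.
Qed.

Lemma path_prefix_trans p q r :
  path_prefix p q -> path_prefix q r -> path_prefix p r.
Proof.
move=> /path_prefixE[pq [s qs]] /path_prefixE[qr [s' rs]].
apply/path_prefixE; split; first by rewrite pq.
by exists (s ++ s'); rewrite rs qs catA.
Qed.

Lemma path_prefix_cmp p q r : path_prefix p r -> path_prefix q r ->
  path_prefix p q \/ path_prefix q p.
Proof.
move=> /path_prefixE[pr [s rs]] /path_prefixE[qr [s' rs']].
have pq : source p = source q by rewrite pr.
have /cat_cmp[[u qu]|[u pu]] : edges p ++ s = edges q ++ s' by rewrite -rs.
- by left; apply/path_prefixE; split=> //; exists u.
- by right; apply/path_prefixE; split=> //; exists u.
Qed.

Lemma path_prefix_cancel p q r : target p = source q -> target p = source r ->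
  path_prefix (pcat p q) (pcat p r) -> path_prefix q r.
Proof.
move=> pq pr /path_prefixE[_ [s]]; rewrite !edges_pcat // -catA.
move/catI => rs.
by apply/path_prefixE; rewrite -pq -pr; split=> //; exists s.
Qed.

End Paths.
Record path_hom (E F : graph) := PathHom {
  phom_fun :> fin_path E -> fin_path F;
  phom_vertex : forall v, exists w, phom_fun (vpath v) = vpath w;
  phom_source : forall p,
    vpath (source (phom_fun p)) = phom_fun (vpath (source p));
  phom_target : forall p,
    vpath (target (phom_fun p)) = phom_fun (vpath (target p));
  phom_cat : forall p q, target p = source q ->
    phom_fun (pcat p q) = pcat (phom_fun p) (phom_fun q) }.

Definition vmap (E F : graph) (f : path_hom E F) (v : vertex E) : vertex F :=
  source (f (vpath v)).

Definition monotone (E F : graph) (f : path_hom E F) : Prop :=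
  forall e e' : edge E, path_prefix (f (epath e)) (f (epath e')) -> e = e'.

Section PathHomTheory.
Variables E F : graph.

Lemma path_hom_eq (f g : path_hom E F) : f =1 g -> f = g.
Proof.
case: f g => [f f1 f2 f3 f4] [g g1 g2 g3 g4] /= /funext fg.
by subst g; congr PathHom; exact: Prop_irrelevance.
Qed.

Variable f : path_hom E F.

Lemma vmapE v : f (vpath v) = vpath (vmap f v).
Proof. by have [w fv] := phom_vertex f v; rewrite /vmap fv. Qed.

Lemma vmap_source p : source (f p) = vmap f (source p).
Proof. by have := phom_source f p; rewrite vmapE => -[]. Qed.

Lemma vmap_target p : target (f p) = vmap f (target p).
Proof. by have := phom_target f p; rewrite vmapE => -[]. Qed.

Lemma phom_composable p q :
  target p = source q -> target (f p) = source (f q).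
Proof. by rewrite vmap_target vmap_source => ->. Qed.

Lemma path_hom_prefix p q : path_prefix p q -> path_prefix (f p) (f q).
Proof.
move=> [r pr ->]; exists (f r); first exact: phom_composable.
exact: phom_cat.
Qed.

Lemma monotone_prefix p q : injective (vmap f) -> monotone f ->
  path_prefix (f p) (f q) -> path_prefix p q \/ path_prefix q p.
Proof.
move=> fI fM; have [n] := ubnP (size (edges p)); elim: n p q => // n IH p q sz.
move=> fpq; have /path_prefixE[+ _] := fpq; rewrite !vmap_source => /fI spq.
case ep : (edges p) sz => [|e s] sz.
  by left; apply/path_prefixE; split=> //; exists (edges q); rewrite ep.
case eq : (edges q) => [|e' s'].
  by right; apply/path_prefixE; split=> //; exists (edges p); rewrite eq.
have [p' [ep' sp' pE]] := fin_path_cons ep.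
have [q' [eq' sq' qE]] := fin_path_cons eq.
have ee' : e = e'.
  have le : path_prefix (f (epath e)) (f q).
    apply: path_prefix_trans fpq; apply: path_hom_prefix; exists p' => //.
  have le' : path_prefix (f (epath e')) (f q).
    by apply: path_hom_prefix; exists q'.
  by have [/fM|/fM] := path_prefix_cmp le le'.
subst e'; move: fpq; rewrite pE qE !phom_cat //.
move=> /path_prefix_cancel /IH[]; rewrite ?ep' //.
- by apply: phom_composable.
- by apply: phom_composable.
- move=> /path_prefixE[? [t et]]; left; apply/path_prefixE.
  rewrite !source_pcat !edges_pcat //; split=> //.
  by exists t; rewrite et catA.
- move=> /path_prefixE[? [t et]]; right; apply/path_prefixE.
  rewrite !source_pcat !edges_pcat //; split=> //.
  by exists t; rewrite et catA.
Qed.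

End PathHomTheory.

Definition path_hom_id (E : graph) : path_hom E E.
Proof. by refine (@PathHom E E id _ _ _ _) => // v; exists v. Defined.

Definition path_hom_comp (E F G : graph) (g : path_hom F G)
  (f : path_hom E F) : path_hom E G.
Proof.
refine (@PathHom E G (g \o f) _ _ _ _) => /=.
- by move=> v; rewrite !vmapE; eexists.
- by move=> p; rewrite phom_source phom_source.
- by move=> p; rewrite phom_target phom_target.
- by move=> p q pq; rewrite !phom_cat //; exact: phom_composable.
Defined.

Definition mipg_morphism (E F : graph) (f : path_hom E F) : Prop :=
  injective (vmap f) /\ monotone f.

Lemma vmap_comp (E F G : graph) (g : path_hom F G) (f : path_hom E F) :
  vmap (path_hom_comp g f) =1 vmap g \o vmap f.
Proof. by move=> v; rewrite /= {1}/vmap /= !vmapE. Qed.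

Lemma mipg_id (E : graph) : mipg_morphism (path_hom_id E).
Proof.
split=> [v w //|e e' /path_prefixE[_ [s /= []]]] //.
Qed.

Lemma mipg_comp (E F G : graph) (g : path_hom F G) (f : path_hom E F) :
  mipg_morphism g -> mipg_morphism f -> mipg_morphism (path_hom_comp g f).
Proof.
move=> [gI gM] [fI fM]; split=> [v w|e e' /= /(monotone_prefix gI gM)].
  by rewrite !vmap_comp /= => /gI /fI.
by case=> /fM.
Qed.

Definition MIPG : category.
Proof.
refine (@Category graph (fun E F => {f : path_hom E F | mipg_morphism f})
  (fun E => exist _ (path_hom_id E) (mipg_id E))
  (fun E F G g f => exist _ (path_hom_comp (sval g) (sval f))
                      (mipg_comp (svalP g) (svalP f))) _ _ _).
- by move=> E F [f fM]; apply: eq_exist; exact: path_hom_eq.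
- by move=> E F [f fM]; apply: eq_exist; exact: path_hom_eq.
- by move=> E F G H h g f; apply: eq_exist; exact: path_hom_eq.
Defined.

Definition bij_on_vertices (E F : MIPG) (f : mor MIPG E F) : Prop :=
  bijective (vmap (sval f)).

Lemma bij_on_vertices_id (E : MIPG) : bij_on_vertices (idm E).
Proof. by exists id. Qed.

Lemma bij_on_vertices_comp (E F G : MIPG) (g : mor MIPG F G)
    (f : mor MIPG E F) :
  bij_on_vertices g -> bij_on_vertices f -> bij_on_vertices (compc g f).
Proof.
move=> gB fB; apply: eq_bij (bij_comp gB fB) _ _.
by move=> v; rewrite vmap_comp.
Qed.

Definition MBPG : category :=
  subcategory (fun E : MIPG => finite_set [set: vertex E])
    bij_on_vertices_id bij_on_vertices_comp.

(* [inl e] is the edge [e], [inr e] is [e^*]. *)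
Definition ext_graph (E : graph) : graph :=
  @Graph (vertex E) (edge E + edge E)
    (fun x => match x with inl e => src e | inr e => tgt e end)
    (fun x => match x with inl e => tgt e | inr e => src e end).

Section ExtendedGraph.
Variable E : graph.

Lemma incl_chain (v : vertex E) (s : seq (edge E)) : chain v s ->
  @chain (ext_graph E) v (map inl s).
Proof. by elim: s v => //= e s IH v [? /IH]. Qed.

Definition path_incl (p : fin_path E) : fin_path (ext_graph E) :=
  FPath (incl_chain (chainP p)).

Lemma star_chain (v : vertex E) (s : seq (edge E)) : chain v s ->
  @chain (ext_graph E) (endpoint v s) (rev (map inr s)) /\
  @endpoint (ext_graph E) (endpoint v s) (rev (map inr s)) = v.
Proof.
elim: s v => //= e s IH v [ev /IH[c t]].
rewrite rev_cons -cats1 (_ : endpoint v (e :: s) = endpoint (tgt e) s) //.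
by split; [apply/chain_cat; rewrite t|rewrite endpoint_cat].
Qed.

Definition star (p : fin_path E) : fin_path (ext_graph E) :=
  FPath (star_chain (chainP p)).1.

Lemma target_path_incl p : target (path_incl p) = target p.
Proof. by rewrite /target /endpoint /= -map_comp. Qed.

Lemma target_star p : target (star p) = source p.
Proof. exact: (star_chain (chainP p)).2. Qed.

End ExtendedGraph.

Section ExtendedHom.
Variables (E F : graph) (f : path_hom E F).

Definition ext_edge (x : edge (ext_graph E)) : fin_path (ext_graph F) :=
  match x with
  | inl e => path_incl (f (epath e))
  | inr e => star (f (epath e))
  end.

(* The product of the paths [ext_edge x]; all of them are composable, see
   [ext_foldl]. *)
Definition ext_map (p : fin_path (ext_graph E)) : fin_path (ext_graph F) :=
  foldl (@pcat (ext_graph F)) (@vpath (ext_graph F) (vmap f (source p)))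
    [seq ext_edge x | x <- edges p].

Lemma source_ext_edge x : source (ext_edge x) = vmap f (src x).
Proof.
case: x => e /=; first exact: vmap_source.
exact: (vmap_target f (epath e)).
Qed.

Lemma target_ext_edge x : target (ext_edge x) = vmap f (tgt x).
Proof.
case: x => e /=; first by rewrite target_path_incl vmap_target.
by rewrite target_star vmap_source.
Qed.

Lemma ext_foldl v (s : seq (edge (ext_graph E))) (p : fin_path (ext_graph F)) :
  chain v s -> target p = vmap f v ->
  let q := foldl (@pcat (ext_graph F)) (@vpath (ext_graph F) (vmap f v))
             [seq ext_edge x | x <- s] in
  [/\ source q = vmap f v, target q = vmap f (endpoint v s) &
    foldl (@pcat (ext_graph F)) p [seq ext_edge x | x <- s] = pcat p q].
Proof.
elim: s v p => [|x s IH] v p /=.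
  by move=> _ pv; split=> //; rewrite pcat_vr.
move=> [xv c] pv; have sx : source (ext_edge x) = vmap f v.
  by rewrite source_ext_edge -xv.
rewrite pcat_vl //.
have [qs qt qE] := IH _ (ext_edge x) c (target_ext_edge x).
have px : target p = source (ext_edge x) by rewrite sx.
have xq : target (ext_edge x) = vmap f (tgt x) by rewrite target_ext_edge.
rewrite qE source_pcat sx target_pcat ?qs //; split=> //.
have [|_ _ ->] := IH _ (pcat p (ext_edge x)) c; first by rewrite target_pcat.
by rewrite pcatA // ?qs.
Qed.

Lemma ext_map_vertex v :
  exists w, ext_map (@vpath (ext_graph E) v) = @vpath (ext_graph F) w.
Proof. by exists (vmap f v). Qed.

Lemma ext_map_source p :
  @vpath (ext_graph F) (source (ext_map p)) =
  ext_map (@vpath (ext_graph E) (source p)).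
Proof.
congr vpath.
by have [] := ext_foldl (p := @vpath (ext_graph F) _) (chainP p) erefl.
Qed.

Lemma ext_map_target p :
  @vpath (ext_graph F) (target (ext_map p)) =
  ext_map (@vpath (ext_graph E) (target p)).
Proof.
congr vpath.
by have [] := ext_foldl (p := @vpath (ext_graph F) _) (chainP p) erefl.
Qed.

Lemma ext_map_cat p q : target p = source q ->
  ext_map (pcat p q) = pcat (ext_map p) (ext_map q).
Proof.
move=> pq; rewrite {1}/ext_map source_pcat edges_pcat // map_cat foldl_cat.
have tp : target (ext_map p) = vmap f (source q).
  by have [->] := ext_map_target p; rewrite pq.
by have [_ _ ->] := ext_foldl (chainP q) tp.
Qed.

Definition ext_hom : path_hom (ext_graph E) (ext_graph F) :=
  PathHom ext_map_vertex ext_map_source ext_map_target ext_map_cat.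

End ExtendedHom.

(* Algebras need not have a unit; the type of algebras in MathComp is that of
   nonzero unital ones, which excludes also the Cohn path algebra of the
   empty graph. *)
Record kalg (k : fieldType) := KAlg {
  kalg_sort :> lmodType k;
  kmul : kalg_sort -> kalg_sort -> kalg_sort;
  kmulA : associative kmul;
  kmul_linl : forall y, linear (kmul^~ y);
  kmul_linr : forall x, linear (kmul x) }.

Arguments kmul {k A} : rename.

Record alg_hom (k : fieldType) (A B : kalg k) := AlgHom {
  alg_fun :> A -> B;
  alg_fun_linear : linear alg_fun;
  alg_funM : forall x y, alg_fun (kmul x y) = kmul (alg_fun x) (alg_fun y) }.

Lemma alg_hom_eq (k : fieldType) (A B : kalg k) (f g : alg_hom A B) :
  f =1 g -> f = g.
Proof.
case: f g => [f f1 f2] [g g1 g2] /= /funext fg.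
by subst g; congr AlgHom; exact: Prop_irrelevance.
Qed.

Definition alg_hom_id (k : fieldType) (A : kalg k) : alg_hom A A.
Proof. by refine (@AlgHom k A A id _ _). Defined.

Definition alg_hom_comp (k : fieldType) (A B C : kalg k) (g : alg_hom B C)
  (f : alg_hom A B) : alg_hom A C.
Proof.
refine (@AlgHom k A C (g \o f) _ _) => [a x y|x y] /=.
- by rewrite !alg_fun_linear.
- by rewrite !alg_funM.
Defined.

Definition KA (k : fieldType) : category.
Proof.
refine (@Category (kalg k) (@alg_hom k) (@alg_hom_id k) (@alg_hom_comp k)
  _ _ _).
- by move=> A B f; exact: alg_hom_eq.
- by move=> A B f; exact: alg_hom_eq.
- by move=> A B C D h g f; exact: alg_hom_eq.
Defined.

(* Being unital is a property of an algebra, and the unit is unique, so UKA is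
   a subcategory of KA; the zero algebra is unital. *)
Definition is_one (k : fieldType) (A : kalg k) (u : A) : Prop :=
  forall x, kmul u x = x /\ kmul x u = x.

Definition unital (k : fieldType) (A : kalg k) : Prop :=
  exists u : A, is_one u.

Definition unital_hom (k : fieldType) (A B : KA k) (f : mor (KA k) A B) :
    Prop :=
  forall u, is_one u -> is_one ((f : alg_hom A B) u).

Lemma unital_hom_id (k : fieldType) (A : KA k) : unital_hom (idm A).
Proof. by []. Qed.

Lemma unital_hom_comp (k : fieldType) (A B C : KA k) (g : mor (KA k) B C)
    (f : mor (KA k) A B) :
  unital_hom g -> unital_hom f -> unital_hom (compc g f).
Proof. by move=> gU fU u /fU /gU. Qed.

Definition UKA (k : fieldType) : category :=
  subcategory (fun A : KA k => unital A)
    (@unital_hom_id k) (@unital_hom_comp k).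

Definition ideal (k : fieldType) (A : kalg k) (I : set A) : Prop :=
  [/\ I 0, forall a x y, I x -> I y -> I (a *: x + y),
      forall x y, I y -> I (kmul x y) & forall x y, I x -> I (kmul x y)].

(* Boolean, as required by quotients of Z-modules. *)
Definition ideal_gen (k : fieldType) (A : kalg k) (S : set A) : {pred A} :=
  fun x => `[< forall I : set A, ideal I -> S `<=` I -> I x >].

Section QuotientAlgebra.
Variables (k : fieldType) (A : kalg k) (S : set A).

Lemma ideal_genP : ideal [set x | ideal_gen S x].
Proof.
split=> /=.
- by apply/asboolP => I [].
- move=> a x y /asboolP Ix /asboolP Iy; apply/asboolP => I iI SI.
  by case: (iI) => _ h _ _; apply: h; [exact: Ix|exact: Iy].
- move=> x y /asboolP Iy; apply/asboolP => I iI SI.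
  by case: (iI) => _ _ h _; apply: h; exact: Iy.
- move=> x y /asboolP Ix; apply/asboolP => I iI SI.
  by case: (iI) => _ _ _ h; apply: h; exact: Ix.
Qed.

Lemma ideal_gen_zmod_closed : zmod_closed (ideal_gen S).
Proof.
have [I0 IL _ _] := ideal_genP; split=> [|x y Ix Iy]; first exact: I0.
by have := IL (-1) y x Iy Ix; rewrite scaleN1r addrC.
Qed.

HB.instance Definition _ :=
  GRing.isZmodClosed.Build A (ideal_gen S) ideal_gen_zmod_closed.

Definition quot_sort : Type := Quotient.quot (ideal_gen S : zmodClosed A).

HB.instance Definition _ := GRing.Zmodule.on quot_sort.

Definition quot_class (x : A) : quot_sort :=
  \pi_(Quotient.quot (ideal_gen S : zmodClosed A)) x.

Lemma quot_classP x y : quot_class x = quot_class y <-> ideal_gen S (x - y).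
Proof.
rewrite /quot_class; split=> [/eqP|h]; last apply/eqP.
  by rewrite -Quotient.idealrBE.
by rewrite -Quotient.idealrBE.
Qed.

Definition quot_repr (x : quot_sort) : A :=
  repr (x : Quotient.quot (ideal_gen S : zmodClosed A)).

Lemma quot_reprK x : quot_class (quot_repr x) = x.
Proof. exact: reprK. Qed.

Lemma quot_classD x y : quot_class (x + y) = quot_class x + quot_class y.
Proof. exact: raddfD. Qed.

Definition quot_scale (a : k) (x : quot_sort) : quot_sort :=
  quot_class (a *: quot_repr x).

Definition quot_mul (x y : quot_sort) : quot_sort :=
  quot_class (kmul (quot_repr x) (quot_repr y)).

Lemma ideal_gen_repr x : ideal_gen S (quot_repr (quot_class x) - x).
Proof. by apply/quot_classP; rewrite quot_reprK. Qed.

Lemma quot_classZ a x : quot_scale a (quot_class x) = quot_class (a *: x).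
Proof.
apply/quot_classP; rewrite -scalerBr; have [I0 IL _ _] := ideal_genP.
by have := IL a _ 0 (ideal_gen_repr x) I0; rewrite addr0.
Qed.

Lemma kmulBl (x y z : A) : kmul (x - y) z = kmul x z - kmul y z.
Proof.
have := kmul_linl z (-1) y x; rewrite /= !scaleN1r => h.
by rewrite (addrC x) h addrC.
Qed.

Lemma kmulBr (x y z : A) : kmul x (y - z) = kmul x y - kmul x z.
Proof.
have := kmul_linr x (-1) z y; rewrite /= !scaleN1r => h.
by rewrite (addrC y) h addrC.
Qed.

Lemma quot_classM x y :
  quot_mul (quot_class x) (quot_class y) = quot_class (kmul x y).
Proof.
apply/quot_classP; set x' := quot_repr _; set y' := quot_repr _.
have -> : kmul x' y' - kmul x y = 1 *: kmul (x' - x) y' + kmul x (y' - y).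
  by rewrite scale1r kmulBl kmulBr addrA subrK.
have [_ IL Il Ir] := ideal_genP.
by apply: IL; [apply: Ir|apply: Il]; exact: ideal_gen_repr.
Qed.

Lemma quot_scaleA a b x :
  quot_scale a (quot_scale b x) = quot_scale (a * b) x.
Proof. by rewrite -[x]quot_reprK !quot_classZ scalerA. Qed.

Lemma quot_scale1 : left_id 1 quot_scale.
Proof. by move=> x; rewrite -[x]quot_reprK quot_classZ scale1r. Qed.

Lemma quot_scaleDr : right_distributive quot_scale +%R.
Proof.
move=> a x y; rewrite -[x]quot_reprK -[y]quot_reprK.
by rewrite -quot_classD !quot_classZ scalerDr quot_classD.
Qed.

Lemma quot_scaleDl x : {morph quot_scale^~ x : a b / a + b}.
Proof.
move=> a b; rewrite /= -[x]quot_reprK.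
by rewrite !quot_classZ scalerDl quot_classD.
Qed.

HB.instance Definition _ := GRing.Zmodule_isLmodule.Build k quot_sort
  quot_scaleA quot_scale1 quot_scaleDr quot_scaleDl.

Lemma quot_class_linear : linear quot_class.
Proof.
move=> a x y; rewrite quot_classD; congr (_ + _).
by rewrite -quot_classZ.
Qed.

Lemma quot_mulA : associative quot_mul.
Proof.
move=> x y z; rewrite -[x]quot_reprK -[y]quot_reprK -[z]quot_reprK.
by rewrite !quot_classM kmulA.
Qed.

Lemma quot_mul_linl y : linear (quot_mul^~ y).
Proof.
move=> a x z; rewrite -[x]quot_reprK -[y]quot_reprK -[z]quot_reprK.
by rewrite -quot_class_linear !quot_classM kmul_linl quot_class_linear.
Qed.

Lemma quot_mul_linr x : linear (quot_mul x).
Proof.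
move=> a y z; rewrite -[x]quot_reprK -[y]quot_reprK -[z]quot_reprK.
by rewrite -quot_class_linear !quot_classM kmul_linr quot_class_linear.
Qed.

Definition quot_alg : kalg k := KAlg quot_mulA quot_mul_linl quot_mul_linr.

End QuotientAlgebra.

Section LinearExtension.
Variables (k : fieldType) (K : choiceType) (V : lmodType k) (h : K -> V).

Definition lin_ext (x : {malg k[K]}) : V := \sum_(p <- msupp x) x@_p *: h p.

Lemma lin_extEw (d : {fset K}) x :
  fsubset (msupp x) d -> lin_ext x = \sum_(p <- d) x@_p *: h p.
Proof.
move=> xd; apply/big_fset_incl => // p _ /mcoeff_outdom ->.
by rewrite scale0r.
Qed.

Lemma lin_ext_linear : linear lin_ext.
Proof.
move=> a x y; pose d := (msupp (a *: x + y) `|` (msupp x `|` msupp y))%fset.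
rewrite !(@lin_extEw d) ?fsubsetUl //.
- rewrite scaler_sumr -big_split /=; apply: eq_bigr => p _.
  by rewrite mcoeffD mcoeffZ scalerDl scalerA.
- by rewrite /d fsetUA fsubsetUr.
- by rewrite /d fsetUCA fsubsetUl.
Qed.

Lemma lin_extU p : lin_ext << p >> = h p.
Proof.
by rewrite (lin_extEw msuppU_le) big_seq_fset1 mcoeffUU scale1r.
Qed.

End LinearExtension.

Lemma malg_span (k : fieldType) (K : choiceType) (P : {malg k[K]} -> Prop) :
  P 0 -> (forall a x y, P x -> P y -> P (a *: x + y)) ->
  (forall p, P << p >>) -> forall x, P x.
Proof.
move=> P0 PL PU x; rewrite (monalgE x).
elim: (enum_fset _) => [|p s IH]; first by rewrite big_nil.
rewrite big_cons (_ : << _ *g p >> = x@_p *: << p >>); first exact: PL.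
by apply/malgP => q; rewrite mcoeffZ !mcoeffU mulrnAr mulr1.
Qed.

Section PathAlgebra.
Variables (k : fieldType) (E : graph).

Definition chi (p : fin_path E) : {malg k[fin_path E]} := << p >>.

Definition chi_mul (p q : fin_path E) : {malg k[fin_path E]} :=
  if `[< target p = source q >] then chi (pcat p q) else 0.

Definition path_mul (x y : {malg k[fin_path E]}) : {malg k[fin_path E]} :=
  \sum_(p <- msupp x) \sum_(q <- msupp y) (x@_p * y@_q) *: chi_mul p q.

Lemma path_mulE x y :
  path_mul x y = lin_ext (fun p => lin_ext (chi_mul p) y) x.
Proof.
apply: eq_bigr => p _; rewrite scaler_sumr; apply: eq_bigr => q _.
by rewrite scalerA.
Qed.

Lemma path_mul_linl y : linear (path_mul^~ y).
Proof. by move=> a x z; rewrite /= !path_mulE lin_ext_linear. Qed.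

Lemma path_mul_linr x : linear (path_mul x).
Proof.
move=> a y z; rewrite !path_mulE /lin_ext scaler_sumr -big_split /=.
apply: eq_bigr => p _; rewrite -/(lin_ext _ _) lin_ext_linear.
by rewrite scalerDr !scalerA mulrC.
Qed.

Lemma path_mul_chi p q : path_mul (chi p) (chi q) = chi_mul p q.
Proof. by rewrite path_mulE !lin_extU. Qed.

Lemma path_mul0l x : path_mul 0 x = 0.
Proof. by rewrite /path_mul msupp0 big_seq_fset0. Qed.

Lemma path_mul0r x : path_mul x 0 = 0.
Proof. by rewrite /path_mul big1 // => p _; rewrite msupp0 big_seq_fset0. Qed.

Lemma chi_mulA p q r :
  path_mul (chi p) (chi_mul q r) = path_mul (chi_mul p q) (chi r).
Proof.
rewrite /chi_mul; case: asboolP => qr; last first.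
  rewrite path_mul0r; case: asboolP => pq; last by rewrite path_mul0l.
  rewrite path_mul_chi /chi_mul; case: asboolP => //.
  by rewrite target_pcat.
case: asboolP => pq; last first.
  rewrite path_mul0l path_mul_chi /chi_mul; case: asboolP => //.
  by rewrite source_pcat.
rewrite !path_mul_chi /chi_mul source_pcat target_pcat //.
by do 2![case: asboolP => // _]; rewrite pcatA.
Qed.

Lemma path_mulA : associative path_mul.
Proof.
move=> x y z.
elim/malg_span: x => [|a x x' IH IH'|p]; first by rewrite !path_mul0l.
  by rewrite !path_mul_linl IH IH'.
elim/malg_span: y => [|a y y' IH IH'|q].
- by rewrite path_mul0l path_mul0r path_mul0l.
- by rewrite path_mul_linl !path_mul_linr path_mul_linl IH IH'.
elim/malg_span: z => [|a z z' IH IH'|r]; first by rewrite !path_mul0r.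
  by rewrite !path_mul_linr IH IH'.
by rewrite !path_mul_chi chi_mulA.
Qed.

Definition path_alg : kalg k := KAlg path_mulA path_mul_linl path_mul_linr.

End PathAlgebra.

Section CohnPathAlgebra.
Variables (k : fieldType) (E : graph).

Local Notation ee e := (@epath (ext_graph E) (inl e)).
Local Notation es e := (@epath (ext_graph E) (inr e)).
Local Notation vv v := (@vpath (ext_graph E) v).

Definition cohn_relations : set (path_alg k (ext_graph E)) :=
  [set x | exists e e' : edge E,
    x = kmul (chi k (es e) : path_alg k (ext_graph E)) (chi k (ee e'))
        - (`[< e = e' >])%:R *: chi k (vv (tgt e))].

Definition cohn_alg : kalg k := quot_alg cohn_relations.

Definition cohn_chi (p : fin_path (ext_graph E)) : cohn_alg :=
  quot_class cohn_relations (chi k p).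

End CohnPathAlgebra.

(* Main.v *)
Require Import Defs.
From HB Require Import structures.
From mathcomp Require Import all_boot all_algebra boolp classical_sets.
From mathcomp Require Import cardinality.

(** Why the assignment is a functor.

    On path algebras, chi_p |-> chi_(f p) is linear by construction, and it is
    multiplicative because f is injective on vertices: a product chi_p chi_q
    vanishes exactly when p and q do not compose, and injectivity keeps
    non-composable paths non-composable.

    The only real point is that this map kills the Cohn relations.  For edges
    e, e' of E it sends e^* e' to f(e)^* f(e'), and f(e), f(e') are paths of
    any length.  In a Cohn path algebra, p^* q is computed by cancelling the
    first edges of p and q as long as they agree ([cohn_star_cancel]).  If p
    and q are equal, everything cancels and their common target is left
    ([cohn_star_self]).  If neither is a prefix of the other, then either the
    sources differ or one reaches two distinct edges, and the product is zero
    in both cases ([cohn_star_orthogonal]).  Monotonicity of f says precisely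
    that f(e), f(e') are not prefix-comparable when e and e' are different, so
    the relations of E go to zero ([cohn_map_path_relations]).

    Functoriality reduces to the paths, since their classes span the Cohn path
    algebra ([cohn_span]), and then to vertices and edges, since a path
    homomorphism is determined by its values there ([path_hom_ext]); the
    extension to the extended graph commutes with inclusion of paths and with
    the star, hence is compatible with composition ([ext_hom_comp]).

    With finitely many vertices the sum of the vertices is a unit.  If f is
    surjective on vertices, the image of a unit u is again a unit: for a path q
    of F that begins at f(v), f(u) q = f(u) f(v) q = f(u v) q = f(v) q = q, and
    symmetrically on the right. *)

Set Implicit Arguments.
Unset Strict Implicit.
Unset Printing Implicit Defensive.

Import GRing.Theory.
Local Open Scope ring_scope.

(** * Linear maps and quotient algebras *)

Section LinearFunctions.
Variables (k : fieldType) (U V : lmodType k) (f : U -> V).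
Hypothesis f_lin : linear f.

Lemma linear_fun0 : f 0 = 0.
Proof. by have := f_lin (-1) 0 0; rewrite !scaleN1r addr0 oppr0 addNr. Qed.

Lemma linear_funD x y : f (x + y) = f x + f y.
Proof. by have := f_lin 1 x y; rewrite !scale1r. Qed.

Lemma linear_funZ a x : f (a *: x) = a *: f x.
Proof. by have := f_lin a x 0; rewrite !addr0 linear_fun0 addr0. Qed.

Lemma linear_funB x y : f (x - y) = f x - f y.
Proof. by rewrite linear_funD -scaleN1r linear_funZ scaleN1r. Qed.

Lemma linear_fun_sum (I : Type) (s : seq I) (F : I -> U) :
  f (\sum_(i <- s) F i) = \sum_(i <- s) f (F i).
Proof. by apply: big_morph; [exact: linear_funD|exact: linear_fun0]. Qed.

End LinearFunctions.

Section AlgebraFacts.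
Variables (k : fieldType) (A : kalg k).

Lemma kmul0x (x : A) : kmul 0 x = 0.
Proof. exact: (linear_fun0 (kmul_linl x)). Qed.

Lemma kmulx0 (x : A) : kmul x 0 = 0.
Proof. exact: (linear_fun0 (kmul_linr x)). Qed.

End AlgebraFacts.

Section PathAlgebraHom.
Variables (k : fieldType) (E : graph) (B : kalg k) (h : fin_path E -> B).
Hypothesis h_mul : forall p q,
  kmul (h p) (h q) = if `[< target p = source q >] then h (pcat p q) else 0.

(** Both sides are bilinear, so multiplicativity need only hold on pairs of
    basis paths. *)
Lemma lin_ext_mul (x y : path_alg k E) :
  lin_ext h (kmul x y) = kmul (lin_ext h x) (lin_ext h y).
Proof.
have h0 : lin_ext h (0 : path_alg k E) = 0.
  exact: (linear_fun0 (U := path_alg k E) (lin_ext_linear h)).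
elim/malg_span: x => [|a x x' IH IH'|p].
- by rewrite kmul0x h0 kmul0x.
- by rewrite kmul_linl !lin_ext_linear IH IH' kmul_linl.
elim/malg_span: y => [|a y y' IH IH'|q].
- by rewrite kmulx0 h0 kmulx0.
- by rewrite kmul_linr !lin_ext_linear IH IH' kmul_linr.
have -> : kmul (chi k p : path_alg k E) (chi k q) = chi_mul k p q.
  exact: path_mul_chi.
rewrite !lin_extU h_mul /chi_mul; case: ifP => _; [exact: lin_extU|exact: h0].
Qed.

Definition path_alg_hom : alg_hom (path_alg k E) B :=
  @AlgHom k (path_alg k E) B (lin_ext h) (lin_ext_linear h) lin_ext_mul.

Lemma path_alg_hom_chi p : path_alg_hom (chi k p) = h p.
Proof. exact: lin_extU. Qed.

End PathAlgebraHom.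

Section QuotientHom.
Variables (k : fieldType) (A B : kalg k) (S : set A) (phi : alg_hom A B).
Hypothesis phi_S : forall s, S s -> phi s = 0.

(** The kernel of an algebra homomorphism is an ideal, and the generated ideal
    is the smallest one that contains S. *)
Lemma ideal_gen_ker x : ideal_gen S x -> phi x = 0.
Proof.
move=> /asboolP /(_ [set y | phi y = 0]%classic); apply; last exact: phi_S.
have phi_lin := @alg_fun_linear _ _ _ phi.
split=> /= [|a y z y0 z0|y z z0|y z y0].
- exact: linear_fun0.
- by rewrite phi_lin y0 z0 scaler0 addr0.
- by rewrite alg_funM z0 kmulx0.
- by rewrite alg_funM y0 kmul0x.
Qed.

Definition quot_fun (x : quot_alg S) : B := phi (quot_repr x).

Lemma quot_funE x : quot_fun (quot_class S x) = phi x.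
Proof.
apply: subr0_eq; rewrite -(linear_funB (@alg_fun_linear _ _ _ phi)).
exact/ideal_gen_ker/ideal_gen_repr.
Qed.

Lemma quot_fun_linear : linear quot_fun.
Proof.
move=> a x y; rewrite -[x]quot_reprK -[y]quot_reprK.
by rewrite -quot_class_linear !quot_funE alg_fun_linear.
Qed.

Lemma quot_fun_mul (x y : quot_alg S) :
  quot_fun (kmul x y) = kmul (quot_fun x) (quot_fun y).
Proof.
rewrite -[x]quot_reprK -[y]quot_reprK.
have -> : kmul (quot_class S (quot_repr x) : quot_alg S)
            (quot_class S (quot_repr y)) =
          quot_class S (kmul (quot_repr x) (quot_repr y)).
  exact: quot_classM.
by rewrite !quot_funE alg_funM.
Qed.

Definition quot_hom : alg_hom (quot_alg S) B :=
  AlgHom quot_fun_linear quot_fun_mul.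

End QuotientHom.

(** * Paths in the extended graph *)

Section PathHomDetermined.
Variables (E F : graph) (f g : path_hom E F).
Hypothesis fg_vertex : forall v, f (vpath v) = g (vpath v).
Hypothesis fg_edge : forall e, f (epath e) = g (epath e).

(** A path of positive length is the product of its first edge and a shorter
    path. *)
Lemma path_hom_ext p : f p = g p.
Proof.
have [s] : {s | edges p = s} by exists (edges p).
elim: s p => [|e s IH] p ep; first by rewrite (fin_path_nil ep).
have [q [eq sq ->]] := fin_path_cons ep.
by rewrite !phom_cat // fg_edge IH.
Qed.

End PathHomDetermined.

Section InclusionAndStar.
Variable E : graph.

Lemma path_incl_cat (p q : fin_path E) : target p = source q ->
  path_incl (pcat p q) = pcat (path_incl p) (path_incl q).
Proof.
move=> pq; apply: fin_path_eq; first by rewrite /= !source_pcat.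
by rewrite edges_pcat ?target_path_incl //= edges_pcat // map_cat.
Qed.

Definition path_incl_hom : path_hom E (ext_graph E).
Proof.
refine (@PathHom E (ext_graph E) (@path_incl E) _ _ _ _).
- by move=> v; exists v; exact: fin_path_eq.
- by move=> p; exact: fin_path_eq.
- by move=> p; rewrite target_path_incl; exact: fin_path_eq.
- exact: path_incl_cat.
Defined.

Lemma star_cat (p q : fin_path E) : target p = source q ->
  star (pcat p q) = pcat (star q) (star p).
Proof.
move=> pq; apply: fin_path_eq.
  by rewrite source_pcat; exact: (target_pcat pq).
rewrite edges_pcat; last by rewrite target_star -pq.
by rewrite /= edges_pcat // map_cat rev_cat.
Qed.

Lemma star_vpath (v : vertex E) : star (vpath v) = @vpath (ext_graph E) v.
Proof. exact: fin_path_eq. Qed.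

Lemma path_incl_vpath (v : vertex E) :
  path_incl (vpath v) = @vpath (ext_graph E) v.
Proof. exact: fin_path_eq. Qed.

Lemma star_epath (e : edge E) : star (epath e) = @epath (ext_graph E) (inr e).
Proof. exact: fin_path_eq. Qed.

Lemma path_incl_epath (e : edge E) :
  path_incl (epath e) = @epath (ext_graph E) (inl e).
Proof. exact: fin_path_eq. Qed.

End InclusionAndStar.

Section ExtendedHomFunctorial.
Variables (E F : graph) (f : path_hom E F).

Lemma ext_hom_vpath v :
  ext_hom f (@vpath (ext_graph E) v) = @vpath (ext_graph F) (vmap f v).
Proof. by []. Qed.

Lemma ext_hom_epath x : ext_hom f (@epath (ext_graph E) x) = ext_edge f x.
Proof. by rewrite /= /ext_map /= pcat_vl ?source_ext_edge. Qed.

Lemma ext_hom_incl p : ext_hom f (path_incl p) = path_incl (f p).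
Proof.
apply: (@path_hom_ext _ _ (path_hom_comp (ext_hom f) (path_incl_hom E))
                        (path_hom_comp (path_incl_hom F) f)) => [v|e] /=.
- by rewrite -/(ext_hom f _) path_incl_vpath vmapE path_incl_vpath.
- by rewrite -[LHS]/(ext_hom f _) path_incl_epath ext_hom_epath.
Qed.

(** The star reverses paths, so it is no path homomorphism; hence a direct
    induction instead of [path_hom_ext]. *)
Lemma ext_hom_star p : ext_hom f (star p) = star (f p).
Proof.
have [s] : {s | edges p = s} by exists (edges p).
elim: s p => [|e s IH] p ep.
  by rewrite (fin_path_nil ep) star_vpath ext_hom_vpath vmapE star_vpath.
have [q [eq sq ->]] := fin_path_cons ep.
rewrite star_cat // phom_cat; last by rewrite target_star sq.
rewrite IH // star_epath ext_hom_epath phom_cat // star_cat //.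
exact: phom_composable.
Qed.

End ExtendedHomFunctorial.

Lemma ext_hom_id (E : graph) p : ext_hom (path_hom_id E) p = p.
Proof.
apply: (@path_hom_ext _ _ (ext_hom (path_hom_id E))
          (path_hom_id (ext_graph E))) => [v //|x].
by rewrite ext_hom_epath; case: x => e; exact: fin_path_eq.
Qed.

Lemma ext_hom_comp (E F G : graph) (g : path_hom F G) (f : path_hom E F) p :
  ext_hom (path_hom_comp g f) p = ext_hom g (ext_hom f p).
Proof.
apply: (@path_hom_ext _ _ (ext_hom (path_hom_comp g f))
          (path_hom_comp (ext_hom g) (ext_hom f))) => [v|x].
  by rewrite -[RHS]/(ext_hom g (ext_hom f _)) !ext_hom_vpath vmap_comp.
rewrite -[RHS]/(ext_hom g (ext_hom f _)) !ext_hom_epath.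
by case: x => e; rewrite /= -/(ext_hom _ _) -?ext_hom_incl -?ext_hom_star.
Qed.

(** * Products in the Cohn path algebra *)

Section CohnProducts.
Variables (k : fieldType) (E : graph).
Local Notation cchi := (@cohn_chi k E).
Local Notation vv v := (@vpath (ext_graph E) v).

Lemma cohn_span (P : cohn_alg k E -> Prop) :
  P 0 -> (forall a x y, P x -> P y -> P (a *: x + y)) ->
  (forall p, P (cchi p)) -> forall x, P x.
Proof.
move=> P0 PL PU x; rewrite -[x]quot_reprK.
have qlin := @quot_class_linear _ _ (@cohn_relations k E).
elim/malg_span: (quot_repr x) => [|a y z Py Pz|p]; last exact: PU.
- by rewrite (linear_fun0 qlin).
- by rewrite qlin; exact: PL.
Qed.

Lemma cohn_linear_ext (V : lmodType k) (f g : cohn_alg k E -> V) :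
  linear f -> linear g -> (forall p, f (cchi p) = g (cchi p)) -> f =1 g.
Proof.
move=> fL gL fg; apply: cohn_span => [|a x y fgx fgy|//].
- by rewrite !linear_fun0.
- by rewrite fL gL fgx fgy.
Qed.

Lemma cohn_chiM p q :
  kmul (cchi p) (cchi q) =
  if `[< target p = source q >] then cchi (pcat p q) else 0.
Proof.
have -> : kmul (cchi p) (cchi q) =
          quot_class (@cohn_relations k E) (chi_mul k p q).
  by rewrite -path_mul_chi; exact: quot_classM.
rewrite /chi_mul; case: ifP => // _.
exact: (linear_fun0 (@quot_class_linear _ _ (@cohn_relations k E))).
Qed.

Lemma cohn_chi_cat p q : target p = source q ->
  cchi (pcat p q) = kmul (cchi p) (cchi q).
Proof. by move=> pq; rewrite cohn_chiM; case: asboolP. Qed.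

Lemma cohn_chi0 p q : target p <> source q -> kmul (cchi p) (cchi q) = 0.
Proof. by move=> pq; rewrite cohn_chiM; case: asboolP. Qed.

Lemma cohn_vl v p : v = source p -> kmul (cchi (vv v)) (cchi p) = cchi p.
Proof. by move=> vp; rewrite -cohn_chi_cat // pcat_vl. Qed.

Lemma cohn_vr v p : target p = v -> kmul (cchi p) (cchi (vv v)) = cchi p.
Proof. by move=> vp; rewrite -cohn_chi_cat // pcat_vr. Qed.

Lemma cohn_relation (e e' : edge E) :
  kmul (cchi (@epath (ext_graph E) (inr e)))
       (cchi (@epath (ext_graph E) (inl e'))) =
  (`[< e = e' >])%:R *: cchi (vv (tgt e)).
Proof.
have qlin := @quot_class_linear _ _ (@cohn_relations k E).
rewrite /cohn_chi -(linear_funZ qlin).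
apply: etrans (quot_classM _ _ _) _.
apply/quot_classP/asboolP => I _; apply; by exists e, e'.
Qed.

(** The relation e^* e = t(e) applies in the middle of
    (e p)^* (e q) = p^* e^* e q, and a vertex is absorbed by the next path. *)
Lemma cohn_star_cancel (e : edge E) (p q : fin_path E) :
  source p = tgt e -> source q = tgt e ->
  kmul (cchi (star (pcat (epath e) p))) (cchi (path_incl (pcat (epath e) q)))
  = kmul (cchi (star p)) (cchi (path_incl q)).
Proof.
move=> sp sq; rewrite star_cat // path_incl_cat // star_epath path_incl_epath.
rewrite !cohn_chi_cat //; last by rewrite target_star.
rewrite -kmulA (kmulA (cchi (epath _))) cohn_relation.
by case: asboolP => // _; rewrite scale1r cohn_vl.
Qed.

Lemma cohn_star_self (p : fin_path E) :
  kmul (cchi (star p)) (cchi (path_incl p)) = cchi (vv (target p)).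
Proof.
have [s] : {s | edges p = s} by exists (edges p).
elim: s p => [|e s IH] p ep.
  by rewrite (fin_path_nil ep) star_vpath path_incl_vpath cohn_vl.
have [q [eq sq ->]] := fin_path_cons ep.
by rewrite cohn_star_cancel // IH // target_pcat.
Qed.

(** If the sources differ, p^* and q do not compose.  Otherwise p and q have a
    longest common prefix, after which both continue, with distinct edges e, e';
    once the prefix is cancelled, e^* e' = 0 remains in the middle.  Comparability in either direction must be excluded, as
    p^* q is the rest of the longer path (or its star) in that case. *)
Lemma cohn_star_orthogonal (p q : fin_path E) :
  ~ path_prefix p q -> ~ path_prefix q p ->
  kmul (cchi (star p)) (cchi (path_incl q)) = 0.
Proof.
have [s] : {s | edges p = s} by exists (edges p).
elim: s p q => [|e s IH] p q ep npq nqp.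
  apply: cohn_chi0; rewrite target_star => spq; apply: npq.
  by apply/path_prefixE; split=> //; exists (edges q); rewrite ep.
have [spq|spq] := pselect (source p = source q); last first.
  by apply: cohn_chi0; rewrite target_star.
case eq : (edges q) => [|e' s'].
  exfalso; apply: nqp; apply/path_prefixE; split=> //.
  by exists (edges p); rewrite eq.
have [p' [ep' sp' pE]] := fin_path_cons ep.
have [q' [eq' sq' qE]] := fin_path_cons eq.
have [ee'|ee'] := pselect (e = e').
  subst e'; rewrite pE qE cohn_star_cancel //.
  have lift r r' : source r = tgt e -> source r' = tgt e ->
      path_prefix r r' -> path_prefix (pcat (epath e) r) (pcat (epath e) r').
    move=> sr sr' /path_prefixE[_ [t r't]]; apply/path_prefixE.
    by rewrite !source_pcat !edges_pcat // r't; split=> //; exists t.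
  apply: IH => // [pq|qp]; [apply: npq|apply: nqp]; rewrite pE qE; exact: lift.
rewrite pE qE star_cat // path_incl_cat // star_epath path_incl_epath.
rewrite !cohn_chi_cat //; last by rewrite target_star.
rewrite -kmulA (kmulA (cchi (epath _))) cohn_relation.
by case: asboolP => // _; rewrite scale0r kmul0x kmulx0.
Qed.

Lemma is_one_chi (u : cohn_alg k E) :
  (forall p, kmul u (cchi p) = cchi p /\ kmul (cchi p) u = cchi p) -> is_one u.
Proof.
move=> up; apply: cohn_span => [|a x y [ux xu] [uy yu]|//].
- by rewrite kmul0x kmulx0.
- by rewrite kmul_linl kmul_linr ux xu uy yu.
Qed.

(** The unit is the sum of the vertices: in its product with a path, only the
    end vertex of that path survives. *)
Lemma cohn_unital : finite_set [set: vertex E]%classic -> unital (cohn_alg k E).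
Proof.
move=> /(@finite_seqP {classic vertex E})[s0 s0E].
pose s : seq {classic vertex E} := undup s0.
have sT (v : {classic vertex E}) : v \in s.
  have : [set` s0]%classic v by rewrite -s0E.
  by rewrite mem_undup.
exists (\sum_(v <- s) cchi (vv v)); apply: is_one_chi => p; split.
- rewrite (linear_fun_sum (kmul_linl _)).
  rewrite (bigD1_seq (source p : {classic vertex E})) ?undup_uniq //.
  rewrite (cohn_vl (p := p) erefl) big1 => [|v /eqP vp]; first exact: addr0.
  by apply: cohn_chi0.
- rewrite (linear_fun_sum (kmul_linr _)).
  rewrite (bigD1_seq (target p : {classic vertex E})) ?undup_uniq //.
  rewrite (cohn_vr (p := p) erefl) big1 => [|v /eqP vp]; first exact: addr0.
  by apply: cohn_chi0 => pv; exact: vp.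
Qed.

End CohnProducts.

(** * The map induced on Cohn path algebras *)

Section CohnMap.
Variables (k : fieldType) (E F : graph) (f : path_hom E F).
Hypothesis fM : mipg_morphism f.

Lemma cohn_ext_hom_mul p q :
  kmul (cohn_chi k (ext_hom f p)) (cohn_chi k (ext_hom f q)) =
  if `[< target p = source q >] then cohn_chi k (ext_hom f (pcat p q)) else 0.
Proof.
case: asboolP => pq.
  by rewrite phom_cat // cohn_chi_cat //; exact: phom_composable.
apply: cohn_chi0; rewrite vmap_target vmap_source => h; apply: pq.
exact: fM.1 h.
Qed.

Definition cohn_map_path : alg_hom (path_alg k (ext_graph E)) (cohn_alg k F) :=
  path_alg_hom cohn_ext_hom_mul.

(** The one place where monotonicity of f is needed. *)
Lemma cohn_map_path_relations x :
  @cohn_relations k E x -> cohn_map_path x = 0.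
Proof.
move=> [e [e' ->]]; have mlin := @alg_fun_linear _ _ _ cohn_map_path.
rewrite (linear_funB mlin) (linear_funZ mlin) alg_funM !path_alg_hom_chi.
rewrite !ext_hom_epath ext_hom_vpath /ext_edge; case: asboolP => [<-|ee'].
  by rewrite cohn_star_self vmap_target scale1r subrr.
rewrite scale0r subr0; apply: cohn_star_orthogonal => /fM.2 // /esym.
exact: ee'.
Qed.

Definition cohn_map : alg_hom (cohn_alg k E) (cohn_alg k F) :=
  quot_hom cohn_map_path_relations.

Lemma cohn_map_chi p : cohn_map (cohn_chi k p) = cohn_chi k (ext_hom f p).
Proof.
apply: etrans (quot_funE cohn_map_path_relations _) _.
exact: path_alg_hom_chi.
Qed.

(** A unit u of C(E) is not computed: f(u) acts on a path of F as f(u v) = f(v)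
    acts on it, where f(v) is the end of the path on the relevant side. *)
Lemma cohn_map_one : (forall w, exists v, vmap f v = w) ->
  forall u : cohn_alg k E, is_one u -> is_one (cohn_map u).
Proof.
move=> f_surj u u1; apply: is_one_chi => q.
have mv v : cohn_map (cohn_chi k (@vpath (ext_graph E) v)) =
            cohn_chi k (@vpath (ext_graph F) (vmap f v)).
  by rewrite cohn_map_chi.
split.
- have [v vq] := f_surj (source q).
  rewrite -(cohn_vl k (erefl (source q))) kmulA -vq -mv -alg_funM.
  by rewrite (u1 _).1.
- have [v vq] := f_surj (target q).
  rewrite -(cohn_vr k (erefl (target q))) -kmulA -vq -mv -alg_funM.
  by rewrite (u1 _).2.
Qed.

End CohnMap.

Theorem proposition4p3 (k : fieldType) :
  exists fC : forall E F : MIPG,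
      mor MIPG E F -> mor (KA k) (cohn_alg k E) (cohn_alg k F),
    [/\ forall (E F : MIPG) (f : mor MIPG E F) (p : fin_path (ext_graph E)),
          alg_fun (fC E F f) (cohn_chi k p) = cohn_chi k (ext_hom (sval f) p),
        forall (E F : MIPG) (f : mor MIPG E F)
               (g : cohn_alg k E -> cohn_alg k F),
          linear g ->
          (forall p : fin_path (ext_graph E),
             g (cohn_chi k p) = cohn_chi k (ext_hom (sval f) p)) ->
          g = alg_fun (fC E F f),
        is_functor (C := MIPG) (D := KA k) (F0 := cohn_alg k) fC
      & exists (fC_ob : forall E : MBPG, unital (cohn_alg k (sval E)))
               (fC_hom : forall (E F : MBPG) (f : mor MBPG E F),
                  unital_hom (fC (sval E) (sval F) (sval f))),
          is_functor (C := MBPG) (D := UKA k)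
            (F0 := fun E => exist _ (cohn_alg k (sval E)) (fC_ob E))
            (fun E F f => exist _ (fC (sval E) (sval F) (sval f))
                                  (fC_hom E F f))].
Proof.
pose fC (E F : MIPG) (f : mor MIPG E F) : alg_hom (cohn_alg k E) (cohn_alg k F)
  := cohn_map k (svalP f).
have fC_chi E F f p : fC E F f (cohn_chi k p) = cohn_chi k (ext_hom (sval f) p).
  exact: cohn_map_chi.
have fC_id (E : MIPG) : fC E E (idm E) = alg_hom_id (cohn_alg k E).
  apply/alg_hom_eq/cohn_linear_ext => [||p]; try exact: alg_fun_linear.
  by rewrite fC_chi ext_hom_id.
have fC_comp (E F G : MIPG) (g : mor MIPG F G) (f : mor MIPG E F) :
    fC E G (compc g f) = alg_hom_comp (fC F G g) (fC E F f).
  apply/alg_hom_eq/cohn_linear_ext => [||p]; try exact: alg_fun_linear.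
  rewrite fC_chi ext_hom_comp -[RHS]/(fC F G g (fC E F f _)).
  by rewrite !fC_chi.
have fC_ob (E : MBPG) : unital (cohn_alg k (sval E)).
  exact: cohn_unital (svalP E).
have fC_hom (E F : MBPG) (f : mor MBPG E F) :
    unital_hom (A := cohn_alg k (sval E)) (B := cohn_alg k (sval F))
      (fC (sval E) (sval F) (sval f)).
  apply: cohn_map_one => w; have [g _ gK] := svalP f.
  by exists (g w); rewrite gK.
exists fC; split=> //.
- move=> E F f g gL g_chi; apply/funext/cohn_linear_ext => // [|p].
    exact: alg_fun_linear.
  by rewrite g_chi fC_chi.
- exists fC_ob, fC_hom; split=> [E|E F G g f]; apply: eq_exist.
  + exact: fC_id.
  + exact: fC_comp.
Qed.
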